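(* There is an absolute constant $c$ such that the following holds. Let $\mathbf A\in\mathbb R^{m\times n}$, let $\lambda_1\ge\lambda_2\ge\dots\ge\lambda_n$ be the eigenvalues of $\mathbf A^\top\mathbf A$, let $0<c_1\le c_2$ and $\gamma=c_2/c_1$, let $k\in\{1,\dots,n-1\}$ and $S\sim k\text{-}\mathrm{DPP}(\mathbf A^\top\mathbf A)$. 1. (Polynomial decay) If $p>1$ and $c_1i^{-p}\le\lambda_i\le c_2 i^{-p}$ for all $i$, then $\frac{\mathbb E[\mathrm{Er}_{\mathbf A}(S)]}{\mathrm{OPT}_k}\le c\gamma p$. 2. (Exponential decay) If $\delta\in(0,1)$ and $c_1(1-\delta)^i\le\lambda_i\le c_2(1-\delta)^i$ for all $i$, then $\frac{\mathbb E[\mathrm{Er}_{\mathbf A}(S)]}{\mathrm{OPT}_k}\le c\gamma(1+\delta k)$.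
   Context: For $\mathbf A\in\mathbb R^{m\times n}$ with columns $\mathbf a_1,\dots,\mathbf a_n$ and $S\subseteq\{1,\dots,n\}$, $\mathbf P_S$ denotes the orthogonal projection onto $\mathrm{span}\{\mathbf a_i:i\in S\}$ and $\mathrm{Er}_{\mathbf A}(S)=\|\mathbf A-\mathbf P_S\mathbf A\|_F^2$. $\mathrm{OPT}_k=\min_{\mathrm{rank}(\mathbf B)=k}\|\mathbf A-\mathbf B\|_F^2=\sum_{i>k}\lambda_i$. $S\sim k\text{-}\mathrm{DPP}(\mathbf A^\top\mathbf A)$ denotes the distribution over subsets $S\subseteq\{1,\dots,n\}$ with $|S|=k$ and $\Pr(S)\propto\det(\mathbf A_S^\top\mathbf A_S)$, where $\mathbf A_S$ is the submatrix of columns indexed by $S$. *)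

(* Defs.v *)
From HB Require Import structures.
From mathcomp Require Import all_boot all_order all_algebra.
From mathcomp Require Import reals exp.
Set Implicit Arguments. Unset Strict Implicit. Unset Printing Implicit Defensive.
Import Order.TTheory GRing.Theory Num.Theory.
Local Open Scope ring_scope.

Section DPP.
Variable R : realType.

Definition eigs_desc (n : nat) (M : 'M[R]_n) (lam : 'I_n -> R) : Prop :=
  (forall i j : 'I_n, (i <= j)%N -> lam j <= lam i) /\
  char_poly M = \prod_(i < n) ('X - (lam i)%:P).

Definition colsubset (m n : nat) (A : 'M[R]_(m, n)) (S : {set 'I_n}) :
  'M[R]_(m, #|S|) := colsub (fun j : 'I_#|S| => enum_val j) A.

Definition dpp_weight (m n : nat) (A : 'M[R]_(m, n)) (S : {set 'I_n}) : R :=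
  \det ((colsubset A S)^T *m colsubset A S).

(* Orthogonal projection onto span{a_i : i in S}; the formula
   A_S (A_S^T A_S)^{-1} A_S^T is the orthogonal projector whenever A_S has
   full column rank, i.e. whenever dpp_weight A S <> 0, which is the case for
   every S with positive probability under the k-DPP. *)
Definition proj_S (m n : nat) (A : 'M[R]_(m, n)) (S : {set 'I_n}) : 'M[R]_m :=
  colsubset A S *m invmx ((colsubset A S)^T *m colsubset A S) *m (colsubset A S)^T.

Definition frob2 (m n : nat) (B : 'M[R]_(m, n)) : R :=
  \sum_(i < m) \sum_(j < n) (B i j) ^+ 2.

Definition Er (m n : nat) (A : 'M[R]_(m, n)) (S : {set 'I_n}) : R :=
  frob2 (A - proj_S A S *m A).

Definition kdpp_expected_Er (m n : nat) (A : 'M[R]_(m, n)) (k : nat) : R :=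
  (\sum_(S : {set 'I_n} | #|S| == k) dpp_weight A S * Er A S) /
  (\sum_(S : {set 'I_n} | #|S| == k) dpp_weight A S).

(* OPT_k = sum_{i > k} lambda_i (1-based), i.e. 0-based indices i >= k *)
Definition OPT (n : nat) (lam : 'I_n -> R) (k : nat) : R :=
  \sum_(i < n | (k <= i)%N) lam i.

End DPP.

(* Main.v *)
Require Import Defs.
From HB Require Import structures.
From mathcomp Require Import all_boot all_order all_algebra.
From mathcomp Require Import reals exp.
From mathcomp Require Import zify ring lra.
Import Order.TTheory GRing.Theory Num.Theory.
Local Open Scope ring_scope.

(* Idea. Sums of principal k-minors of A^T A are coefficients of its
   characteristic polynomial, and a Schur complement turns det(A_S^T A_S) times
   the squared distance of a_j to the span of A_S into the minor for S + j.
   Hence E[Er_A(S)] = (k+1) e_{k+1}(lambda) / e_k(lambda).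
   For weights v with 0 <= v_i <= 1 and v_i = 1 for i > k, every T with
   |T| = k+1 satisfies v_1 + ... + v_{k+1} <= sum_{i in T} v_i; double counting
   pairs (T, i in T) then gives
     (v_1 + ... + v_{k+1}) e_{k+1} <= (B + OPT_k) e_k,
   where B bounds the sum of v_i lambda_i over i <= k, i not in S, uniformly in
   S; as |~: S| = n - k, both sum_{i <= k} v_i lambda_i and
   (n - k) max_{i <= k} v_i lambda_i are admissible values of B. The second one
   matters when the tail lambda_{k+1}, ..., lambda_n is short.
   Weights proportional to lambda_i^-2 make B = O(gamma OPT_k) for both decay
   rates. *)

(** * Principal minors and the characteristic polynomial *)

Lemma le_of_eq {disp : Order.disp_t} {T : porderType disp} (x y : T) :
  x = y -> (x <= y)%O.
Proof. by move->. Qed.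

(** Sylvester's identity: one block matrix is triangularised in two ways, by clearing either
    off-diagonal block. *)
Lemma det_1D_mulmxC (R : comNzRingType) (m n : nat) (X : 'M[R]_(m, n))
    (Y : 'M[R]_(n, m)) :
  \det (1%:M + X *m Y) = \det (1%:M + Y *m X).
Proof.
have El : block_mx 1%:M (- X) Y 1%:M =
    block_mx (1%:M + X *m Y) (- X) 0 1%:M *m block_mx 1%:M 0 Y 1%:M.
  by rewrite mulmx_block !(mulmx1, mulmx0, mul0mx, mul1mx, add0r) mulNmx addrK.
have Er : block_mx 1%:M (- X) Y 1%:M =
    block_mx 1%:M 0 Y 1%:M *m block_mx 1%:M (- X) 0 (1%:M + Y *m X).
  rewrite mulmx_block !(mulmx1, mulmx0, mul0mx, mul1mx, add0r, addr0) mulmxN.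
  by rewrite addrC addrK.
have := congr1 determinant El.
by rewrite {1}Er !det_mulmx !det_ublock !det_lblock !det1 !(mul1r, mulr1).
Qed.

(** The principal minor on [S] as an [n]-by-[n] determinant: identity rows outside [S] keep the type
    independent of [#|S|]. *)
Definition minor_mx {R : comNzRingType} {n : nat} (M : 'M[R]_n)
    (S : {set 'I_n}) : 'M[R]_n :=
  \matrix_(i, j) if i \in S then M i j else (i == j)%:R.

Lemma minor_mxE {R : comNzRingType} {n : nat} (M : 'M[R]_n) (S : {set 'I_n}) :
  minor_mx M S = 1%:M + diag_mx (\row_i (i \in S)%:R) *m (M - 1%:M).
Proof.
apply/matrixP => i j; rewrite mul_diag_mx !mxE.
by case: (i \in S); rewrite ?mul1r ?mul0r ?addr0 // addrCA subrr addr0.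
Qed.

(** Sylvester's identity moves [Q^T] to the other side. Any [Q] that lists the coordinates of [S] in
    some order is allowed. *)
Lemma det_minor_mx {R : comNzRingType} {n s : nat} (M : 'M[R]_n)
    (S : {set 'I_n}) (Q : 'M[R]_(s, n)) :
  Q *m Q^T = 1%:M -> Q^T *m Q = diag_mx (\row_i (i \in S)%:R) ->
  \det (Q *m M *m Q^T) = \det (minor_mx M S).
Proof.
move=> QQ1 QQS; rewrite minor_mxE -QQS -[Q^T *m Q *m _]mulmxA -det_1D_mulmxC.
by rewrite mulmxBr mulmx1 mulmxBl QQ1 addrCA subrr addr0.
Qed.

Lemma minor_mxN {R : comNzRingType} {n : nat} (M : 'M[R]_n) (S : {set 'I_n}) :
  \det (minor_mx (- M) S) = (- 1) ^+ #|S| * \det (minor_mx M S).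
Proof.
have -> : minor_mx (- M) S =
    diag_mx (\row_i if i \in S then - 1 else 1) *m minor_mx M S.
  apply/matrixP => i j; rewrite mul_diag_mx !mxE.
  by case: ifP; rewrite ?mulN1r ?mul1r.
rewrite det_mulmx det_diag; congr (_ * _).
under eq_bigr do rewrite mxE.
by rewrite -big_mkcond /= prodr_const.
Qed.

Lemma minor_mx_map {R R' : comNzRingType} (f : {rmorphism R -> R'}) {n : nat}
    (M : 'M[R]_n) (S : {set 'I_n}) :
  minor_mx (map_mx f M) S = map_mx f (minor_mx M S).
Proof. by apply/matrixP => i j; rewrite !mxE; case: ifP; rewrite ?rmorph_nat. Qed.

Lemma prod_if_card {R : comNzRingType} {n : nat} (S : {set 'I_n}) (a : R)
    (F G : 'I_n -> R) :
  \prod_i (if i \in S then F i else a * G i) =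
  a ^+ (n - #|S|) * \prod_i (if i \in S then F i else G i).
Proof.
have <- : \prod_i (if i \in S then 1 else a) = a ^+ (n - #|S|).
  have -> : (n - #|S| = #|~: S|)%N by rewrite [in RHS]cardsCs setCK card_ord.
  rewrite -prodr_const [RHS](eq_bigl (fun i => i \notin S)); last first.
    by move=> i; rewrite inE.
  by rewrite [RHS]big_mkcond /=; apply: eq_bigr => i _; case: (i \in S).
by rewrite -big_split /=; apply: eq_bigr => i _; case: (i \in S); rewrite ?mul1r.
Qed.

(** For each permutation in the Leibniz formula, expand the product by the set [S] of rows that use
    [M] rather than [a%:M]. *)
Lemma det_scalar_add {R : comNzRingType} {n : nat} (a : R) (M : 'M[R]_n) :
  \det (a%:M + M) = \sum_(S : {set 'I_n}) a ^+ (n - #|S|) * \det (minor_mx M S).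
Proof.
under [RHS]eq_bigr do rewrite big_distrr /=.
rewrite exchange_big /=; apply: eq_bigr => s _.
under eq_bigr do rewrite !mxE addrC -mulr_natr.
rewrite bigA_distr big_distrr /=; apply: eq_bigr => S _.
rewrite prod_if_card mulrCA; congr (_ * (_ * _)).
by apply: eq_bigr => i _; rewrite !mxE.
Qed.

Lemma prod_scalar_add {R : comNzRingType} {n : nat} (a : R) (x : 'I_n -> R) :
  \prod_i (a + x i) = \sum_(S : {set 'I_n}) a ^+ (n - #|S|) * \prod_(i in S) x i.
Proof.
rewrite (eq_bigr (fun i => x i + a * 1)) => [|i _]; last by rewrite mulr1 addrC.
rewrite bigA_distr; apply: eq_bigr => S _.
by rewrite prod_if_card -big_mkcond.
Qed.

Lemma coef_sum_subsets {R : comNzRingType} {n k : nat} (c : {set 'I_n} -> R) :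
  (k <= n)%N ->
  (\sum_(S : {set 'I_n}) 'X ^+ (n - #|S|) * (c S)%:P)`_(n - k) =
  \sum_(S : {set 'I_n} | #|S| == k) c S.
Proof.
move=> kn; rewrite coef_sum [RHS]big_mkcond /=; apply: eq_bigr => S _.
have Sn : (#|S| <= n)%N by rewrite -[X in (_ <= X)%N]card_ord max_card.
by rewrite coefMC coefXn eqn_sub2lE // eq_sym; case: eqP; rewrite ?mul1r ?mul0r.
Qed.

(** Up to the sign [(- 1) ^+ k], both sides are the coefficient of ['X ^+ (n - k)] in
    [char_poly M]. *)
Lemma sum_minors {R : comNzRingType} {n k : nat} {M : 'M[R]_n}
    {lam : 'I_n -> R} :
  char_poly M = \prod_i ('X - (lam i)%:P) -> (k <= n)%N ->
  \sum_(S : {set 'I_n} | #|S| == k) \det (minor_mx M S) =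
  \sum_(S : {set 'I_n} | #|S| == k) \prod_(i in S) lam i.
Proof.
move=> chM kn.
apply: (@lreg_sign R k).
rewrite !mulr_sumr.
rewrite (eq_bigr (fun S => \det (minor_mx (- M) S))); last first.
  by move=> S /eqP <-; rewrite minor_mxN.
rewrite [RHS](eq_bigr (fun S : {set 'I_n} => \prod_(i in S) - lam i)); last first.
  by move=> S /eqP <-; rewrite prodrN.
rewrite -!coef_sum_subsets //; congr ((polyseq _)`__).
transitivity (char_poly M).
  have -> : char_poly M = \det ('X%:M + map_mx polyC (- M)) by rewrite map_mxN.
  have minorC S :
      \det (minor_mx (map_mx polyC (- M)) S) = (\det (minor_mx (- M) S))%:P.
    by rewrite minor_mx_map det_map_mx.
  by rewrite det_scalar_add; under [RHS]eq_bigr do rewrite minorC.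
rewrite chM prod_scalar_add.
apply: eq_bigr => S _; congr (_ * _).
by rewrite rmorph_prod; apply: eq_bigr => i _; rewrite rmorphN.
Qed.

(** * Schur complements, Gram matrices and the error of a column subset *)

Lemma det_block_schur (R : comUnitRingType) (m n : nat) (A : 'M[R]_m)
    (B : 'M[R]_(m, n)) (C : 'M[R]_(n, m)) (D : 'M[R]_n) :
  A \in unitmx ->
  \det (block_mx A B C D) = \det A * \det (D - C *m invmx A *m B).
Proof.
move=> Au.
have -> : block_mx A B C D = block_mx 1%:M 0 (C *m invmx A) 1%:M *m
    block_mx A B 0 (D - C *m invmx A *m B).
  rewrite mulmx_block !(mul0mx, mul1mx, mulmx0, addr0) mulmxKV //.
  by rewrite addrCA subrr addr0.
by rewrite det_mulmx det_lblock det_ublock !det1 !mul1r.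
Qed.

Definition selmx {R : nzRingType} {n : nat} (S : {set 'I_n}) : 'M[R]_(#|S|, n) :=
  rowsub (fun j : 'I_#|S| => enum_val j) 1%:M.

Section Gram.
Context {R : realType} {m n : nat}.
Implicit Types (A : 'M[R]_(m, n)) (S : {set 'I_n}).

Lemma selmx_mul_tr S : selmx S *m (selmx S)^T = 1%:M :> 'M[R]_#|S|.
Proof.
apply/matrixP => i j; rewrite !mxE (bigD1 (enum_val i)) //= big1 => [|l li].
  by rewrite !mxE eqxx mul1r addr0 eq_sym (inj_eq enum_val_inj).
by rewrite !mxE eq_sym (negPf li) mul0r.
Qed.

Lemma tr_selmx_mul S :
  (selmx S)^T *m selmx S = diag_mx (\row_i (i \in S)%:R) :> 'M[R]_n.
Proof.
apply/matrixP => i j; rewrite !mxE.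
under eq_bigr do rewrite !mxE.
have [iS|iNS] := boolP (i \in S); last first.
  rewrite mul0rn big1 // => l _; case: eqP => [li|_]; last by rewrite mul0r.
  by rewrite -li enum_valP in iNS.
rewrite (bigD1 (enum_rank_in iS i)) //= enum_rankK_in // eqxx mul1r.
rewrite big1 ?addr0 // => l li; case: eqP => [il|_]; last by rewrite mul0r.
by case/eqP: li; apply: enum_val_inj; rewrite enum_rankK_in.
Qed.

Lemma colsubsetE A S : colsubset A S = A *m (selmx S)^T.
Proof.
apply/matrixP => i j; rewrite !mxE (bigD1 (enum_val j)) //= big1 => [|l lj].
  by rewrite !mxE eqxx mulr1 addr0.
by rewrite !mxE eq_sym (negPf lj) mulr0.
Qed.

Lemma gram_colsubset A S :
  (colsubset A S)^T *m colsubset A S =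
  selmx S *m (A^T *m A) *m (selmx S)^T.
Proof. by rewrite colsubsetE trmx_mul trmxK !mulmxA. Qed.

Lemma dpp_weightE A S : dpp_weight A S = \det (minor_mx (A^T *m A) S).
Proof.
rewrite /dpp_weight gram_colsubset.
exact: det_minor_mx (selmx_mul_tr S) (tr_selmx_mul S).
Qed.

(* [A^T (1 - P_S) A], whose diagonal holds the squared residual norms of the
   columns *)
Definition residual_gram A S : 'M[R]_n :=
  let M := A^T *m A in let Q := selmx S in
  M - M *m Q^T *m invmx (Q *m M *m Q^T) *m Q *m M.

(** The residual entry at [j] is the Schur complement of the Gram block of [S] in the Gram matrix of
    [j |: S]. *)
Lemma dpp_weightU1 A S j : dpp_weight A S != 0 -> j \notin S ->
  dpp_weight A (j |: S) = dpp_weight A S * residual_gram A S j j.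
Proof.
move=> wN0 jNS; rewrite [LHS]dpp_weightE.
pose M := A^T *m A; pose Q : 'M[R]_(#|S|, n) := selmx S.
pose e : 'rV[R]_n := delta_mx 0 j.
have Qe : Q *m e^T = 0.
  apply/matrixP => i l; rewrite trmx_delta [l]ord1 -colE !mxE.
  by case: eqP => // ij; rewrite -ij enum_valP in jNS.
have Mu : Q *m M *m Q^T \in unitmx.
  by rewrite unitmxE -gram_colsubset unitfE.
(* [col_mx Q e] lists [j] last, whatever its place in the enumeration of [j |: S]; this gives the
   block shape. *)
rewrite -(@det_minor_mx _ _ (#|S| + 1)%N M _ (col_mx Q e)); first last.
- rewrite tr_col_mx mul_row_col tr_selmx_mul trmx_delta mul_delta_mx.
  apply/matrixP => i l; rewrite !mxE in_setU1.
  have [->|ij] := eqVneq i j; last by rewrite addr0.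
  by rewrite (negPf jNS) mul0rn add0r eq_sym.
- rewrite tr_col_mx mul_col_row selmx_mul_tr Qe.
  have -> : e *m Q^T = 0 by rewrite -[e]trmxK -trmx_mul Qe trmx0.
  by rewrite trmx_delta mul_delta_mx [delta_mx _ _]mx11_scalar mxE !eqxx -scalar_mx_block.
rewrite mul_col_mx tr_col_mx mul_col_row det_block_schur //.
rewrite -/M -/Q /dpp_weight gram_colsubset; congr (_ * _).
rewrite [X in \det X]mx11_scalar det_scalar1 /residual_gram -/M -/Q.
set N := M - _.
have -> : e *m M *m e^T - e *m M *m Q^T *m invmx (Q *m M *m Q^T) *m (Q *m M *m e^T) =
    e *m N *m e^T.
  by rewrite /N mulmxBr mulmxBl !mulmxA.
by rewrite trmx_delta -colE -rowE !mxE.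
Qed.

Lemma residual_gram_in A S j : dpp_weight A S != 0 -> j \in S ->
  residual_gram A S j j = 0.
Proof.
move=> wN0 jS; rewrite /residual_gram.
pose M := A^T *m A; pose Q : 'M[R]_(#|S|, n) := selmx S.
have Mu : Q *m M *m Q^T \in unitmx.
  by rewrite unitmxE -gram_colsubset unitfE.
rewrite -/M -/Q; set N := M - _.
(* The residual annihilates the coordinates in [S], and the basis vector at [j] is one of them. *)
have NQ : N *m Q^T = 0.
  by rewrite mulmxBl -(mulmxA _ Q M) -(mulmxA _ (Q *m M)) mulmxKV // subrr.
have -> : N j j = (N *m delta_mx j (0 : 'I_1)) j 0 by rewrite -colE [RHS]mxE.
suff -> : delta_mx j 0 = Q^T *m (Q *m delta_mx j (0 : 'I_1)).
  by rewrite mulmxA NQ mul0mx mxE.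
rewrite mulmxA tr_selmx_mul; apply/matrixP => i l.
by rewrite mul_diag_mx !mxE; case: eqP => [->|]; rewrite ?jS ?mul1r ?mulr0.
Qed.

Lemma Er_residual A S : dpp_weight A S != 0 ->
  Er A S = \sum_j residual_gram A S j j.
Proof.
move=> wN0; pose Q : 'M[R]_(#|S|, n) := selmx S.
pose M := A^T *m A; pose G := invmx (Q *m M *m Q^T).
have Mu : Q *m M *m Q^T \in unitmx.
  by rewrite unitmxE -gram_colsubset unitfE.
pose X := A - proj_S A S *m A.
have XE : X = A - A *m Q^T *m G *m Q *m M.
  by rewrite /X /proj_S /G /M gram_colsubset colsubsetE trmx_mul trmxK !mulmxA.
have GT : G^T = G.
  by rewrite /G /M trmx_inv !trmx_mul !trmxK !mulmxA.
have -> : residual_gram A S = X^T *m X.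
  have -> : X^T = A^T - M *m Q^T *m G *m Q *m A^T.
    by rewrite XE linearB /= !trmx_mul !trmxK GT !mulmxA.
  (* Normal equations: the residual [X] is orthogonal to the selected columns, so only [A^T *m X]
     survives in [X^T *m X]. *)
  have QX : Q *m A^T *m X = 0.
    rewrite XE mulmxBr !mulmxA -!(mulmxA _ A^T A) -/M mulmxV // mul1mx.
    by rewrite subrr.
  rewrite mulmxBl -[_ *m A^T]mulmxA -[_ *m (Q *m A^T) *m _]mulmxA QX mulmx0 subr0.
  by rewrite /residual_gram -/M -/Q -/G XE mulmxBr !mulmxA.
rewrite /Er /frob2 exchange_big /=; apply: eq_bigr => j _.
by rewrite [RHS]mxE; apply: eq_bigr => i _; rewrite [X^T _ _]mxE expr2.
Qed.

Lemma dpp_weight_Er A S : dpp_weight A S != 0 ->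
  dpp_weight A S * Er A S = \sum_(j | j \notin S) dpp_weight A (j |: S).
Proof.
move=> wN0; rewrite Er_residual // mulr_sumr [RHS]big_mkcond /=.
apply: eq_bigr => j _; case: ifPn => [jNS|/negPn jS].
  by rewrite dpp_weightU1.
by rewrite residual_gram_in // mulr0.
Qed.

(** If [K] annihilates the Gram matrix of [A_S], then [Y = K *m A_S^T] satisfies [Y *m Y^T = 0], so
    its rows have zero norm and [Y = 0]. Invertibility of [A^T *m A] then forces [K = 0]. *)
Lemma dpp_weight_neq0 A S : A^T *m A \in unitmx -> dpp_weight A S != 0.
Proof.
move=> Mu; rewrite -unitfE -unitmxE -row_free_unit -kermx_eq0.
set K := kermx _; apply/eqP.
have KA : K *m (colsubset A S)^T = 0.
  set Y := K *m _.
  have YY : Y *m Y^T = 0.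
    rewrite [X in _ *m X]trmx_mul trmxK mulmxA -[Y *m _]mulmxA mulmx_ker.
    by rewrite mul0mx.
  apply/matrixP => i j; apply/eqP; rewrite [X in _ == X]mxE.
  have /eqP := congr1 (fun N : 'M_ _ => N i i) YY.
  rewrite [X in X == _]mxE [X in _ == X]mxE psumr_eq0 => [/allP YY0|l _]; last first.
    by rewrite [_^T _ _]mxE -expr2 sqr_ge0.
  have /implyP/(_ isT) := YY0 j (mem_index_enum _).
  by rewrite [_^T _ _]mxE mulf_eq0 orbb.
have : K *m selmx S *m (A^T *m A) = 0.
  by rewrite mulmxA -[_ *m A^T]mulmxA -[selmx S]trmxK -trmx_mul -colsubsetE KA mul0mx.
move=> /(congr1 (fun N => N *m invmx (A^T *m A))).
rewrite mulmxK // mul0mx => /(congr1 (fun N => N *m (selmx S)^T)).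
by rewrite -mulmxA selmx_mul_tr mulmx1 mul0mx.
Qed.

End Gram.

(** * The expected error as a ratio of elementary symmetric polynomials *)

Lemma sum_subsets_add1 (V : nmodType) (n k : nat) (F : {set 'I_n} -> 'I_n -> V) :
  \sum_(S : {set 'I_n} | #|S| == k) \sum_(j | j \notin S) F (j |: S) j =
  \sum_(T : {set 'I_n} | #|T| == k.+1) \sum_(j in T) F T j.
Proof.
rewrite (exchange_big_dep xpredT) //= [RHS](exchange_big_dep xpredT) //=.
apply: eq_bigr => j _.
(* For fixed [j], removing and adding [j] are inverse bijections between the sets [T] containing [j]
   and the sets [S] avoiding it. *)
rewrite (reindex_onto (fun T => T :\ j) (fun S => j |: S)) /=; last first.
  by move=> S /andP[_ jNS]; rewrite setU1K.
apply: eq_big => [T|T /andP[_ /eqP->]] //.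
rewrite !inE eqxx /= andbT.
have [jT|jNT] := boolP (j \in T).
  by rewrite setD1K // eqxx !andbT [in RHS](cardsD1 j T) jT add1n eqSS.
rewrite andbF; apply/negP => /andP[_ /eqP TE].
by move: jNT; rewrite -TE setU11.
Qed.

Lemma kdpp_expected_ErE (R : realType) (m n k : nat) (A : 'M[R]_(m, n))
    (lam : 'I_n -> R) :
  char_poly (A^T *m A) = \prod_i ('X - (lam i)%:P) -> (forall i, 0 < lam i) ->
  (k < n)%N ->
  kdpp_expected_Er A k =
  k.+1%:R * (\sum_(T : {set 'I_n} | #|T| == k.+1) \prod_(i in T) lam i) /
  (\sum_(S : {set 'I_n} | #|S| == k) \prod_(i in S) lam i).
Proof.
move=> chA lam0 kn.
have Mu : A^T *m A \in unitmx.
  rewrite -row_free_unit -kermx_eq0; apply: contraT => kerN0.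
  have : eigenvalue (A^T *m A) 0 by rewrite /eigenvalue /eigenspace raddf0 subr0.
  rewrite eigenvalue_root_char chA => /rootP; rewrite horner_prod => /eqP.
  rewrite prodf_seq_eq0 => /hasP[i _ /=]; rewrite hornerXsubC sub0r oppr_eq0.
  by rewrite gt_eqF.
rewrite /kdpp_expected_Er.
under eq_bigr do rewrite dpp_weight_Er ?dpp_weight_neq0 //.
(* Each [T] of size [k.+1] arises from [k.+1] pairs [(S, j)], whence the factor [k.+1%:R]. *)
rewrite (sum_subsets_add1 _ _ _ (fun T _ => dpp_weight A T)).
rewrite (eq_bigr (fun T => k.+1%:R * \det (minor_mx (A^T *m A) T))); last first.
  by move=> T /eqP Tk; rewrite sumr_const Tk dpp_weightE mulr_natl.
rewrite -mulr_sumr (sum_minors chA) //; congr (_ / _).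
by under eq_bigr do rewrite dpp_weightE; rewrite (sum_minors chA) // ltnW.
Qed.

(** * Weighted double counting *)

Section WeightedBound.
Context {R : realType} {n k : nat} (lam : 'I_n -> R) (v : nat -> R) (B : R).
Hypotheses (kn : (k < n)%N) (lam_gt0 : forall i, 0 < lam i).
Hypotheses (v_ge0 : forall i, 0 <= v i) (v_le1 : forall i, v i <= 1).
Hypothesis v_tail : forall i, (k <= i)%N -> v i = 1.

Let E (l : nat) : R := \sum_(S : {set 'I_n} | #|S| == l) \prod_(i in S) lam i.

(** Compare deficits: [1 - v i] is nonnegative and vanishes from [k] on, so its sum over [T] is at
    most its total, which the first [k.+1] indices already reach. *)
Lemma sum_weights_ge (T : {set 'I_n}) : #|T| = k.+1 ->
  \sum_(i < k.+1) v i <= \sum_(i in T) v i.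
Proof.
move=> Tk.
rewrite -(subKr k.+1%:R (\sum_(i < _) _)) -(subKr k.+1%:R (\sum_(i in _) _)).
rewrite lerB //.
have -> : k.+1%:R - \sum_(i in T) v i = \sum_(i in T) (1 - v i).
  by rewrite sumrB sumr_const Tk.
have -> : k.+1%:R - \sum_(i < k.+1) v i = \sum_(i < n) (1 - v i).
  rewrite -{1}(card_ord k.+1) -sumr_const -sumrB (big_ord_widen n (fun i => 1 - v i)) //.
  rewrite big_mkcond /=; apply: eq_bigr => i _; case: ltnP => // ki.
  by rewrite v_tail ?subrr // ltnW.
rewrite [leRHS](bigID (mem T)) /= lerDl sumr_ge0 // => i _.
by rewrite subr_ge0.
Qed.

Lemma esym_ratio_le :
  (forall S : {set 'I_n}, #|S| = k ->
     \sum_(i | (i \notin S) && (i < k)%N) v i * lam i <= B) ->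
  (\sum_(i < k.+1) v i) * E k.+1 <= (B + OPT lam k) * E k.
Proof.
move=> leB; rewrite !mulr_sumr.
(* The middle term counts each [T] with the total weight of its elements; regrouping by [S = T :\ i]
   then isolates a sum over the complement of [S]. *)
apply: (@le_trans _ _ (\sum_(T : {set 'I_n} | #|T| == k.+1)
    \sum_(i in T) v i * lam i * \prod_(l in T :\ i) lam l)).
  apply: ler_sum => T /eqP Tk.
  have -> : \sum_(i in T) v i * lam i * \prod_(l in T :\ i) lam l =
      (\sum_(i in T) v i) * \prod_(l in T) lam l.
    rewrite mulr_suml; apply: eq_bigr => i iT.
    by rewrite [in RHS](big_setD1 i) //= mulrA.
  rewrite ler_wpM2r ?sum_weights_ge // prodr_ge0 // => i _.
  exact: ltW.
rewrite -(sum_subsets_add1 _ _ _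
  (fun T i => v i * lam i * \prod_(l in T :\ i) lam l)).
apply: ler_sum => S /eqP Sk.
have -> : \sum_(j | j \notin S) v j * lam j * \prod_(l in (j |: S) :\ j) lam l =
    (\sum_(j | j \notin S) v j * lam j) * \prod_(l in S) lam l.
  by rewrite mulr_suml; apply: eq_bigr => j jS; rewrite setU1K.
apply: ler_wpM2r; first by rewrite prodr_ge0 // => i _; exact: ltW.
rewrite (bigID (fun i : 'I_n => (i < k)%N)) /= lerD ?leB //.
rewrite /OPT [leRHS](bigID (mem S)) /= addrC ler_wpDr //.
  by rewrite sumr_ge0 // => i _; exact: ltW.
apply: le_of_eq.
apply: eq_big => [i|i /andP[_ ik]]; first by rewrite -leqNgt andbC.
by rewrite v_tail ?mul1r // leqNgt.
Qed.
End WeightedBound.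

(** Reduces both decay rates to two estimates on a model spectrum [mu]: the tail bound controls [B],
    and [K] is the loss in replacing the total weight by [k.+1]. *)
Lemma kdpp_ratio_le (R : realType) (m n k : nat) (A : 'M[R]_(m, n))
    (lam : 'I_n -> R) (mu v : nat -> R) (c1 c2 K : R) :
  eigs_desc (A^T *m A) lam -> 0 < c1 -> c1 <= c2 -> (k < n)%N ->
  (forall i, 0 < mu i) ->
  (forall i : 'I_n, c1 * mu i <= lam i <= c2 * mu i) ->
  (forall i, 0 <= v i <= 1) -> (forall i, (k <= i)%N -> v i = 1) ->
  (forall i, (i < k)%N -> v i * mu i <= mu k) ->
  Num.min (\sum_(i < k) v i * mu i) ((n - k)%:R * mu k) <=
    2 * \sum_(k <= i < n) mu i ->
  k.+1%:R <= K * \sum_(i < k.+1) v i ->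
  kdpp_expected_Er A k / OPT lam k <= 3 * K * (c2 / c1).
Proof.
move=> [_ chA] c10 c12 kn mu0 lamP v01 v1 vmu tailP KP.
have c20 : 0 < c2 by exact: lt_le_trans c12.
have v0 i : 0 <= v i by case/andP: (v01 i).
have lam0 i : 0 < lam i.
  by case/andP: (lamP i) => + _; apply: lt_le_trans; rewrite mulr_gt0.
set O := OPT lam k.
set Om := \sum_(k <= i < n) mu i.
have OmE : Om = \sum_(i < n | (k <= i)%N) mu i by rewrite /Om big_geq_mkord.
have O_ge : c1 * Om <= O.
  by rewrite OmE mulr_sumr; apply: ler_sum => i _; case/andP: (lamP i).
have Om0 : 0 < Om.
  rewrite /Om big_ltn //; apply: ltr_wpDr => //.
  by apply: sumr_ge0 => i _; exact: ltW.
have O0 : 0 < O by apply: lt_le_trans O_ge; exact: mulr_gt0.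
set e := fun l => \sum_(S : {set 'I_n} | #|S| == l) \prod_(i in S) lam i.
have e_ge0 l : 0 <= e l.
  by apply: sumr_ge0 => S _; apply: prodr_ge0 => i _; exact: ltW.
set V := \sum_(i < k.+1) v i in KP *.
have V0 : 0 < V.
  by rewrite /V big_ord_recr /= v1 // ltr_wpDl // sumr_ge0.
have K0 : 0 <= K.
  by rewrite -(pmulr_lge0 _ V0); apply: le_trans KP; exact: ler0n.
have main : V * e k.+1 <= (2 * c2 * Om + O) * e k.
  apply: esym_ratio_le => // [i|S Sk]; first by case/andP: (v01 i).
  have lt1 : \sum_(i | (i \notin S) && (i < k)%N) v i * lam i <=
      c2 * \sum_(i < k) v i * mu i.
    rewrite (big_ord_widen n (fun i => v i * mu i)) ?(ltnW kn) // mulr_sumr.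
    rewrite [leRHS](bigID (fun i => i \notin S)) /= ler_wpDr //.
      by apply: sumr_ge0 => i _; rewrite !mulr_ge0 // ltW.
    rewrite (eq_bigl (fun i : 'I_n => (i < k)%N && (i \notin S))); last first.
      by move=> i; rewrite andbC.
    apply: ler_sum => i _; rewrite mulrCA ler_wpM2l //.
    by case/andP: (lamP i).
  (* The complement of [S] has [n - k] indices, and each term is at most [c2 * mu k]. *)
  have lt2 : \sum_(i | (i \notin S) && (i < k)%N) v i * lam i <=
      c2 * ((n - k)%:R * mu k).
    have -> : c2 * ((n - k)%:R * mu k) = \sum_(i | i \notin S) c2 * mu k.
      rewrite sumr_const mulrCA mulr_natl; congr (_ *+ _).
      have := cardC (mem S); rewrite card_ord Sk => nE.
      by rewrite -[X in (X - _)%N]nE addKn.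
    rewrite big_mkcondr /=; apply: ler_sum => i _; case: ltnP => ik.
      apply: (@le_trans _ _ (c2 * (v i * mu i))); last first.
        by apply: ler_wpM2l; [exact: ltW | exact: vmu].
      by rewrite mulrCA ler_wpM2l //; case/andP: (lamP i).
    by rewrite mulr_ge0 // ltW.
  rewrite -mulrA mulrCA; apply: le_trans (ler_wpM2l (ltW c20) tailP).
  by rewrite minr_pMr ?(ltW c20) // le_min lt1 lt2.
rewrite (kdpp_expected_ErE _ _ _ _ _ _ chA) // -/(e k.+1) -/(e k).
rewrite ler_pdivrMr //.
have [->|ek0] := eqVneq (e k) 0.
  by rewrite invr0 mulr0 !mulr_ge0 // ?invr_ge0 ltW.
have ekP : 0 < e k by rewrite lt_def ek0 e_ge0.
rewrite ler_pdivrMr //.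
apply: (@le_trans _ _ (K * V * e k.+1)); first by rewrite ler_wpM2r.
(* Here 3 = 2 + 1: the 2 comes from [B = 2 * c2 * Om] with [Om <= O / c1], the 1 from [O] with
   [1 <= c2 / c1]. *)
have -> : 3 * K * (c2 / c1) * O * e k =
    K * ((2 * c2 * (O / c1) + c2 / c1 * O) * e k) by ring.
rewrite -mulrA ler_wpM2l // (le_trans main) // ler_wpM2r // lerD //.
  by rewrite ler_wpM2l ?mulr_ge0 ?(ltW c20) // ler_pdivlMr // mulrC.
by rewrite ler_peMl ?(ltW O0) // ler_pdivlMr // mul1r.
Qed.

(** * Bernoulli-type inequalities and discrete integral comparisons *)

Section Estimates.
Context {R : realType}.
Implicit Types (a p q x y : R) (k n N : nat).

(** With [y = a * N], this is [min 1 y <= 2 * y / (1 + y)] scaled by [M / a]. In use, [N] is the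
    tail length, [M] its first term, and [z] accounts for the cut-off at [n]. *)
Lemma min_le_sat {N z a M S : R} : 0 < a -> 0 <= N -> 0 <= M ->
  S <= M / a -> z <= (1 + a * N)^-1 ->
  Num.min S (N * M) <= 2 * (M * (1 - z) / a).
Proof.
move=> a0 N0 M0 SM zle.
have y0 : 0 <= a * N by rewrite mulr_ge0 // ltW.
apply: (@le_trans _ _ (M / a * Num.min 1 (a * N))).
  rewrite minr_pMr ?divr_ge0 ?(ltW a0) // mulr1 le_min !ge_min SM /=.
  by apply/orP; right; rewrite mulrA divfK ?gt_eqF // mulrC.
have -> : 2 * (M * (1 - z) / a) = M / a * (2 * (1 - z)) by ring.
rewrite ler_wpM2l ?divr_ge0 ?(ltW a0) //.
move: (a * N) y0 zle => y y0 zle.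
have y1 : 0 < 1 + y by lra.
apply: (@le_trans _ _ (2 * (1 - (1 + y)^-1))); last by rewrite ler_pM2l ?lerB.
have -> : 2 * (1 - (1 + y)^-1) = 2 * y / (1 + y) by field; rewrite gt_eqF.
by rewrite ler_pdivlMr //; case: (leP 1 y) => h; nra.
Qed.

(** Induction, from [(1 - d) * (1 + d * (l + 1)) = 1 + d * l - d ^+ 2 * (l + 1)]. *)
Lemma expr_le_inv {d : R} (l : nat) : 0 <= d <= 1 ->
  (1 - d) ^+ l <= (1 + d * l%:R)^-1.
Proof.
move=> /andP[d0 d1].
elim: l => [|l IH]; first by rewrite expr0 mulr0 addr0 invr1.
have h0 : 0 <= d * l%:R by rewrite mulr_ge0.
rewrite exprS (le_trans (ler_wpM2l _ IH)) ?subr_ge0 // -natr1.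
rewrite ler_pdivrMr; last lra.
rewrite mulrC ler_pdivlMr; last nra.
nra.
Qed.

(** Bernoulli's inequality, from Young's inequality for [t] and 1 with exponents [a] and
    [a / (a - 1)]; [a = 1] has no finite conjugate and is treated apart. *)
Lemma powR_ge1D (a t : R) : 1 <= a -> 0 <= t -> 1 + a * (t - 1) <= t `^ a.
Proof.
move=> a1 t0; have a0 : 0 < a by exact: lt_le_trans a1.
have [->|aN1] := eqVneq a 1; first by rewrite powRr1 // mul1r addrC subrK.
have a1' : 1 < a by rewrite lt_def aN1.
pose b := a / (a - 1).
have b0 : 0 < b by rewrite divr_gt0 // subr_gt0.
have abE : a^-1 + b^-1 = 1.
  by rewrite /b; field; rewrite !gt_eqF // subr_gt0.
have := conjugate_powR t0 ler01 a0 b0 abE.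
rewrite mulr1 powR1 mul1r => h.
have bE : b^-1 = 1 - a^-1 by rewrite -abE addrAC subrr add0r.
rewrite bE in h.
have : a * t <= a * (t `^ a / a + (1 - a^-1)) by rewrite ler_wpM2l // ltW.
have -> : a * (t `^ a / a + (1 - a^-1)) = t `^ a + a - 1 by field; rewrite gt_eqF.
lra.
Qed.

(** Bernoulli's inequality at [x / y], scaled by [y] to the power [a + 1]. *)
Lemma powR_tangent (a x y : R) : 0 <= a -> 0 <= x -> 0 < y ->
  y `^ (a + 1) + (a + 1) * y `^ a * (x - y) <= x `^ (a + 1).
Proof.
move=> a0 x0 y0.
have y1 b : y `^ (b + 1) = y `^ b * y.
  by rewrite powRD ?(gt_eqF y0) ?implybT // powRr1 // ltW.
have t0 : 0 <= x / y by rewrite divr_ge0 // ltW.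
have := @powR_ge1D (a + 1) (x / y) _ t0; rewrite lerDr => /(_ a0).
rewrite -(@ler_pM2r _ (y `^ (a + 1))) ?powR_gt0 // -powRM ?(ltW y0) //.
rewrite divfK ?gt_eqF // => /(le_trans _); apply.
rewrite y1; apply: le_of_eq; field.
by rewrite gt_eqF.
Qed.

Lemma powRN_tangent (p y : R) : 0 < p -> 0 < y ->
  y `^ (- p) - (y + 1) `^ (- p) <= p * y `^ (- p - 1).
Proof.
move=> p0 y0.
have y1 : y `^ (- p - 1) = y `^ (- p) / y.
  by rewrite powRD ?(gt_eqF y0) ?implybT // powR_inv1 // ltW.
pose t := 1 + y^-1.
have t0 : 0 < t by rewrite /t ltr_wpDr // ?invr_ge0 // ltW.
have -> : y + 1 = y * t by rewrite /t mulrDr mulr1 divff // gt_eqF.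
rewrite powRM ?(ltW y0) ?(ltW t0) // y1.
(* Uses [expR u >= 1 + u] at [u = - p * ln t], then [ln t <= y^-1]. *)
have tp : 1 - p / y <= t `^ (- p).
  rewrite /powR gt_eqF //; apply: le_trans (expR_ge1Dx _).
  have iy0 : 0 < y^-1 by rewrite invr_gt0.
  have : ln t <= y^-1 by apply: le_ln1Dx; lra.
  nra.
rewrite -subr_ge0; set P := y `^ _; set T := t `^ _ in tp *.
have -> : p * (P / y) - (P - P * T) = P * (T - (1 - p / y)) by ring.
by rewrite mulr_ge0 ?powR_ge0 // subr_ge0.
Qed.

(** Telescopes the tangent at [l.+1] evaluated at [l]; the upper bound below evaluates it at
    [l.+2]. *)
Lemma sum_powR_ge (a : R) (l : nat) : 0 <= a ->
  l%:R `^ (a + 1) <= (a + 1) * \sum_(i < l) i.+1%:R `^ a.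
Proof.
move=> a0; have a1 : a + 1 != 0 by rewrite gt_eqF //; lra.
elim: l => [|l IH]; first by rewrite powR0 // big_ord0 mulr0.
rewrite big_ord_recr /= mulrDr.
have := @powR_tangent a l%:R l.+1%:R a0 (ler0n _ _) (ltr0Sn _ _).
rewrite -natr1; lra.
Qed.

Lemma sum_powR_le (a : R) (l : nat) : 0 <= a ->
  (a + 1) * \sum_(i < l) i.+1%:R `^ a <= l.+1%:R `^ (a + 1).
Proof.
move=> a0; elim: l => [|l IH]; first by rewrite big_ord0 mulr0 powR_ge0.
rewrite big_ord_recr /= mulrDr.
have := @powR_tangent a l.+2%:R l.+1%:R a0 (ler0n _ _) (ltr0Sn _ _).
rewrite -[l.+2%:R]natr1; lra.
Qed.

Lemma sum_powRN_ge (p : R) (k n : nat) : 0 < p -> (k <= n)%N ->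
  k.+1%:R `^ (- p) - n.+1%:R `^ (- p) <=
    p * \sum_(k <= i < n) i.+1%:R `^ (- p - 1).
Proof.
move=> p0 kn; rewrite -[leLHS]opprB.
rewrite -(telescope_sumr (fun i => i.+1%:R `^ (- p)) kn) -sumrN mulr_sumr.
apply: ler_sum => i _; rewrite opprB.
by have := powRN_tangent _ _ p0 (ltr0Sn R i); rewrite natr1.
Qed.

Lemma sum_geometric (q : R) (l : nat) :
  (1 - q) * \sum_(i < l) q ^+ i = 1 - q ^+ l.
Proof. by rewrite -[1 - q]opprB mulNr -subrX1 opprB. Qed.

(** * Tail and weight estimates for the two decay rates *)

(** The weighted terms are [mu k * q ^+ (k - i)], a geometric sum below [mu k / d]; the tail is
    [mu k * (1 - q ^+ (n - k)) / d]. *)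
Lemma exp_decay_tail (d : R) (k n : nat) : 0 < d < 1 -> (k < n)%N ->
  Num.min (\sum_(i < k) (1 - d) ^+ (2 * (k - i)) * (1 - d) ^+ i.+1)
    ((n - k)%:R * (1 - d) ^+ k.+1) <= 2 * \sum_(k <= i < n) (1 - d) ^+ i.+1.
Proof.
move=> /andP[d0 d1] kn; set q := 1 - d; pose mu i := q ^+ i.+1.
change (Num.min (\sum_(i < k) q ^+ (2 * (k - i)) * mu i) ((n - k)%:R * mu k) <=
  2 * \sum_(k <= i < n) mu i).
have q0 : 0 <= q by rewrite /q; lra.
have q1 : q <= 1 by rewrite /q; lra.
have dE : d = 1 - q by rewrite /q; ring.
have -> : \sum_(k <= i < n) mu i = mu k * (1 - q ^+ (n - k)) / d.
  rewrite -{1}[k]add0n big_addn big_mkord -sum_geometric -dE.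
  rewrite mulrCA mulrAC divff ?gt_eqF // mul1r mulr_sumr.
  by apply: eq_bigr => i _; rewrite /mu addnC -addSn exprD.
apply: min_le_sat => //; first exact: exprn_ge0.
- rewrite ler_pdivlMr // mulrC.
  apply: (@le_trans _ _ (d * (mu k * \sum_(i < k) q ^+ i))); last first.
    rewrite mulrCA dE sum_geometric ler_piMr ?exprn_ge0 //.
    by rewrite gerBl exprn_ge0.
  rewrite ler_wpM2l ?(ltW d0) // mulr_sumr (reindex_inj rev_ord_inj) /=.
  apply: ler_sum => i _; rewrite /mu -!exprD ler_wiXn2l //.
  have := ltn_ord i; lia.
by apply: expr_le_inv; rewrite ltW //= ltW.
Qed.

(** The 4 is 2 * 2: once from [1 - q ^+ 2 <= 2 * d] in the geometric sum, once from
    [1 + d * (k + 1) <= 2 * (1 + d * k)]. *)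
Lemma exp_decay_weight (d : R) (k : nat) : 0 < d < 1 ->
  k.+1%:R <= 4 * (1 + d * k%:R) * \sum_(i < k.+1) (1 - d) ^+ (2 * (k - i)).
Proof.
move=> /andP[d0 d1]; set q := 1 - d.
have q0 : 0 <= q by rewrite /q; lra.
have q1 : q <= 1 by rewrite /q; lra.
rewrite (reindex_inj rev_ord_inj) /=.
under eq_bigr => i _ do rewrite subSS subKn ?exprM -1?ltnS //.
set V := \sum_(i < _) _.
have VE : (1 - q ^+ 2) * V = 1 - (q ^+ 2) ^+ k.+1 by rewrite sum_geometric.
have V0 : 0 <= V by apply: sumr_ge0 => i _; rewrite !exprn_ge0.
have zle : (q ^+ 2) ^+ k.+1 <= (1 + d * k.+1%:R)^-1.
  apply: le_trans (expr_le_inv k.+1 _); last by rewrite ltW //= ltW.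
  by rewrite -exprM ler_wiXn2l // leq_pmull.
have y0 : 0 < 1 + d * k.+1%:R by rewrite ltr_wpDr // mulr_ge0 // ltW.
have key : d * k.+1%:R <= 2 * d * V * (1 + d * k.+1%:R).
  rewrite -ler_pdivrMr //; apply: (@le_trans _ _ (1 - (1 + d * k.+1%:R)^-1)).
    apply: le_of_eq; field.
    by rewrite nat1r gt_eqF.
  apply: (@le_trans _ _ ((1 - q ^+ 2) * V)); first by rewrite VE lerB.
  by rewrite ler_wpM2r // /q; nra.
have : k.+1%:R <= 2 * V * (1 + d * k.+1%:R).
  rewrite -(ler_pM2l d0) (le_trans key) //.
  by apply: le_of_eq; ring.
move=> /le_trans; apply.
rewrite [leLHS](_ : _ = 2 * (1 + d * k.+1%:R) * V); last by ring.
rewrite ler_wpM2r // -natr1.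
have : 0 <= d * k%:R by rewrite mulr_ge0 // ltW.
lra.
Qed.

Lemma powRD_pos (x a b : R) : 0 < x -> x `^ (a + b) = x `^ a * x `^ b.
Proof. by move=> x0; rewrite powRD // (gt_eqF x0) implybT. Qed.

Lemma poly_decay_tail (p : R) (k n : nat) : 1 < p -> (k < n)%N ->
  Num.min
    (\sum_(i < k) i.+1%:R `^ (2 * p) * k.+1%:R `^ (- (2 * p)) * i.+1%:R `^ (- p))
    ((n - k)%:R * k.+1%:R `^ (- p)) <= 2 * \sum_(k <= i < n) i.+1%:R `^ (- p).
Proof.
move=> p1 kn; have p0 : 0 < p by lra.
pose mu (i : nat) : R := i.+1%:R `^ (- p).
change (Num.min
  (\sum_(i < k) i.+1%:R `^ (2 * p) * k.+1%:R `^ (- (2 * p)) * mu i)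
  ((n - k)%:R * mu k) <= 2 * \sum_(k <= i < n) mu i).
have d0 : 0 < k.+1%:R :> R by [].
set d : R := k.+1%:R in d0 *.
pose z := n.+1%:R `^ (- p) / mu k.
have mu0 : 0 < mu k by exact: powR_gt0.
(* Integral comparison for exponent [- p - 1], where one factor of each term is at most [d^-1]; so
   [p / d] plays the part of the rate [a]. *)
have tail : mu k * (1 - z) / (p / d) <= \sum_(k <= i < n) mu i.
  have -> : mu k * (1 - z) = mu k - n.+1%:R `^ (- p).
    by rewrite mulrBr mulr1 /z mulrCA divff ?mulr1 // gt_eqF.
  rewrite ler_pdivrMr ?divr_gt0 //.
  apply: le_trans (sum_powRN_ge _ _ _ p0 (ltnW kn)) _.
  rewrite mulrC mulr_suml mulr_suml big_nat_cond [leRHS]big_nat_cond.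
  apply: ler_sum => i /andP[/andP[ki _] _].
  have i0 : 0 < i.+1%:R :> R by [].
  rewrite powRD_pos // powR_inv1 ?(ltW i0) //.
  rewrite -mulrA ler_wpM2l ?powR_ge0 // mulrC ler_wpM2l ?(ltW p0) //.
  by rewrite lef_pV2 // ler_nat.
apply: (@le_trans _ _ (2 * (mu k * (1 - z) / (p / d)))); last by rewrite ler_pM2l.
apply: min_le_sat => //; first by rewrite divr_gt0.
- exact: ltW.
- rewrite [leLHS](_ : _ = d `^ (- (2 * p)) * \sum_(i < k) i.+1%:R `^ p); last first.
    rewrite mulr_sumr; apply: eq_bigr => i _.
    by rewrite /mu mulrAC mulrC -powRD_pos //; congr (_ * _ `^ _); ring.
  have -> : mu k / (p / d) = d `^ (- (2 * p)) * (d `^ (p + 1) / p).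
    rewrite powRD_pos // powRr1 ?(ltW d0) // /mu -/d.
    have -> : - p = - (2 * p) + p by ring.
    by rewrite powRD_pos // invf_div !mulrA.
  rewrite ler_wpM2l ?powR_ge0 // ler_pdivlMr // mulrC.
  apply: le_trans (sum_powR_le p k (ltW p0)).
  by rewrite ler_wpM2r ?sumr_ge0 // => [i _|]; [exact: powR_ge0 | lra].
have nE : n.+1%:R = d * (1 + (n - k)%:R / d).
  by rewrite mulrDr mulr1 mulrCA divff ?gt_eqF // mulr1 /d -natrD addSn subnKC // ltnW.
have t0 : 0 <= 1 + (n - k)%:R / d by rewrite addr_ge0 // divr_ge0.
rewrite /z nE powRM ?(ltW d0) // mulrAC divff ?gt_eqF // mul1r powRN.
(* Bernoulli's inequality for [n.+1%:R / d], whose power [- p] is [z]. *)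
have h : 1 + p / d * (n - k)%:R <= (1 + (n - k)%:R / d) `^ p.
  have := powR_ge1D _ _ (ltW p1) t0; rewrite [1 + _ - 1]addrAC subrr add0r.
  by rewrite mulrA mulrAC.
have h0 : 0 < 1 + p / d * (n - k)%:R.
  by rewrite ltr_wpDr // mulr_ge0 // divr_ge0 // ltW.
by rewrite lef_pV2 // posrE (lt_le_trans h0).
Qed.

Lemma poly_decay_weight (p : R) (k : nat) : 1 < p ->
  k.+1%:R <= (2 * p + 1) *
    \sum_(i < k.+1) i.+1%:R `^ (2 * p) * k.+1%:R `^ (- (2 * p)).
Proof.
move=> p1; have d0 : 0 < k.+1%:R :> R by [].
rewrite -mulr_suml mulrA.
have p20 : 0 <= 2 * p by lra.
rewrite powRN ler_pdivlMr ?powR_gt0 // mulrC.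
by have := sum_powR_ge _ k.+1 p20; rewrite powRD_pos // powRr1.
Qed.

End Estimates.

(** * Choice of weights and of the absolute constant *)

Theorem theorem2 (R : realType) :
  exists c : R,
  forall (m n : nat) (A : 'M[R]_(m, n)) (lam : 'I_n -> R) (c1 c2 : R) (k : nat),
    eigs_desc (A^T *m A) lam ->
    0 < c1 -> c1 <= c2 ->
    (0 < k)%N -> (k < n)%N ->
    (forall p : R, 1 < p ->
       (forall i : 'I_n, c1 * (i.+1%:R) `^ (- p) <= lam i <= c2 * (i.+1%:R) `^ (- p)) ->
       kdpp_expected_Er A k / OPT lam k <= c * (c2 / c1) * p) /\
    (forall delta : R, 0 < delta < 1 ->
       (forall i : 'I_n, c1 * (1 - delta) ^+ i.+1 <= lam i <= c2 * (1 - delta) ^+ i.+1) ->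
       kdpp_expected_Er A k / OPT lam k <= c * (c2 / c1) * (1 + delta * k%:R)).
Proof.
(* The exponential case gives 3 * 4; the polynomial one needs only [3 * (2 * p + 1) <= 12 * p], true
   for [p > 1]. *)
exists 12 => m n A lam c1 c2 k eigA c10 c12 _ kn.
have g0 : 0 <= c2 / c1 by rewrite divr_ge0 // ltW // (lt_le_trans c10).
split=> [p p1 lamP|d d01 lamP].
  have p0 : 0 <= 2 * p by lra.
  have d0 : 0 < k.+1%:R :> R by [].
  (* The squared ratio of [mu k] to [mu i], capped at 1 from [k] on by [minn]. *)
  pose v (i : nat) : R := (minn i k).+1%:R `^ (2 * p) * k.+1%:R `^ (- (2 * p)).
  have vE i : (i <= k)%N -> v i = i.+1%:R `^ (2 * p) * k.+1%:R `^ (- (2 * p)).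
    by move=> ik; rewrite /v (minn_idPl ik).
  have v1 i : (k <= i)%N -> v i = 1.
    by move=> ki; rewrite /v (minn_idPr ki) -powRD_pos // subrr powRr0.
  have v01 i : 0 <= v i <= 1.
    rewrite /v mulr_ge0 ?powR_ge0 //= powRN ler_pdivrMr ?powR_gt0 // mul1r.
    by rewrite ge0_ler_powR ?nnegrE // ler_nat ltnS geq_minr.
  have vmu i : (i < k)%N -> v i * i.+1%:R `^ (- p) <= k.+1%:R `^ (- p).
    move=> ik; rewrite vE 1?ltnW // mulrAC -powRD_pos //.
    have -> : 2 * p + - p = p by ring.
    have -> : - p = p + - (2 * p) by ring.
    rewrite [leRHS]powRD_pos // ler_wpM2r ?powR_ge0 //.
    by rewrite ge0_ler_powR ?nnegrE ?ler_nat 1?ltnW //; lra.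
  have tailP := @poly_decay_tail R p k n p1 kn.
  have KP := @poly_decay_weight R p k p1.
  apply: le_trans (@kdpp_ratio_le R m n k A lam (fun i => i.+1%:R `^ (- p)) v c1 c2
    (2 * p + 1) eigA c10 c12 kn _ lamP v01 v1 vmu _ _) _.
  - by move=> i; rewrite powR_gt0.
  - apply: le_trans tailP; apply: le_of_eq.
    by congr (Num.min _ _); apply: eq_bigr => i _; rewrite vE // ltnW.
  - apply: le_trans KP _; apply: le_of_eq.
    by congr (_ * _); apply: eq_bigr => i _; rewrite vE // -ltnS.
  - rewrite [leRHS]mulrAC ler_wpM2r //; lra.
have [d0 d1] := andP d01.
have q0 : 0 < 1 - d by lra.
have q1 : 1 - d <= 1 by lra.
(* Again the squared ratio of [mu k] to [mu i]; truncated subtraction makes the weight 1 for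
   [i >= k]. *)
apply: le_trans (@kdpp_ratio_le R m n k A lam (fun i => (1 - d) ^+ i.+1)
  (fun i => (1 - d) ^+ (2 * (k - i))) c1 c2 (4 * (1 + d * k%:R))
  eigA c10 c12 kn _ lamP _ _ _ _ _) _.
- by move=> i; rewrite exprn_gt0.
- by move=> i; rewrite exprn_ge0 ?exprn_ile1 // ltW.
- by move=> i ki; rewrite (eqP ki) muln0.
- move=> i ik; rewrite -exprD ler_wiXn2l ?(ltW q0) //; lia.
- exact: exp_decay_tail.
- exact: exp_decay_weight.
- by apply: le_of_eq; ring.
Qed.
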